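(* Let $d\geq 1$. With the notation below, \[ \omega_d(H_{\max}) = \frac{d}{(d-1)^{(d-1)/d}} \quad\text{if } d\geq 2,\qquad \omega_d(H_{\min}) = 2,\qquad \omega_d(H_{\mathrm{prod}}) = \frac{2}{d}. \]
   Context: Fix $d\geq 1$ and let $\|\cdot\|$ be the max norm on $\mathbb{R}^d$. For a function $\Theta:\mathbb{N}^d\to\mathbb{N}$, the height function $H_\Theta:\mathbb{Q}^d\to\mathbb{N}$ is $H_\Theta(p_1/q_1,\ldots,p_d/q_d)=\Theta(q_1,\ldots,q_d)$, where each $p_i/q_i$ is in reduced form with $q_i\geq 1$. $H_{\max},H_{\min},H_{\mathrm{prod}}$ are the height functions for $\Theta$ equal to the maximum, minimum, and product of $q_1,\ldots,q_d$ respectively. For a height function $H$ and $\mathbf{x}\in\mathbb{R}^d\setminus\mathbb{Q}^d$, the exponent of irrationality is $\omega_H(\mathbf{x})=\liminf_{\mathbf{r}\in\mathbb{Q}^d,\ \mathbf{r}\to\mathbf{x}} \frac{-\log\|\mathbf{x}-\mathbf{r}\|}{\log H(\mathbf{r})}$, equivalently the supremum of all $\alpha\geq 0$ such that $\|\mathbf{x}-\mathbf{r}_n\|<H(\mathbf{r}_n)^{-\alpha}$ for some sequence $\mathbb{Q}^d\ni\mathbf{r}_n\to\mathbf{x}$. The exponent of irrationality of $H$ is $\omega_d(H)=\inf_{\mathbf{x}\in\mathbb{R}^d\setminus\mathbb{Q}^d}\omega_H(\mathbf{x})$. *)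

(* Defs.v *)
From HB Require Import structures.
From mathcomp Require Import all_boot all_order all_algebra.
From mathcomp Require Import all_classical all_reals all_analysis.

Set Implicit Arguments.
Unset Strict Implicit.
Unset Printing Implicit Defensive.
Import Order.TTheory GRing.Theory Num.Theory.
Import numFieldNormedType.Exports.

Local Open Scope classical_set_scope.
Local Open Scope ring_scope.

Definition height (d : nat) (Theta : ('I_d -> nat) -> nat)
    (r : 'rV[rat]_d) : nat :=
  Theta (fun i => `|denq (r ord0 i)|%N).

Definition theta_max (d : nat) (q : 'I_d -> nat) : nat :=
  (\max_(i < d) q i)%N.

(* [minn] has no neutral element; starting from the maximum of the [q i] gives
   their minimum whenever [0 < d]. *)
Definition theta_min (d : nat) (q : 'I_d -> nat) : nat :=
  (\big[minn/theta_max q]_(i < d) q i)%N.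

Definition theta_prod (d : nat) (q : 'I_d -> nat) : nat :=
  (\prod_(i < d) q i)%N.

Definition H_max (d : nat) : 'rV[rat]_d -> nat := height (@theta_max d).
Definition H_min (d : nat) : 'rV[rat]_d -> nat := height (@theta_min d).
Definition H_prod (d : nat) : 'rV[rat]_d -> nat := height (@theta_prod d).

Definition rat_point (R : realType) (d : nat) (r : 'rV[rat]_d) : 'rV[R]_d :=
  map_mx ratr r.

(* The exponent of irrationality of [x], valued in [0, +oo] when [x] is not
   rational: the supremum of the [alpha >= 0] for which some sequence of
   rational points tending to [x] satisfies
   `|x - r_n| < H(r_n)^(- alpha).  The norm on 'rV[R]_d is the max norm.
   This is the upper limit of - log `|x - r| / log H(r) as r tends to [x] (the
   ratio being +oo where H(r) = 1). *)
Definition irr_exponent_at (R : realType) (d : nat) (H : 'rV[rat]_d -> nat)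
    (x : 'rV[R]_d) : \bar R :=
  ereal_sup [set alpha%:E | alpha in [set alpha : R | 0 <= alpha /\
    exists r : nat -> 'rV[rat]_d,
      (rat_point R (r n) @[n --> \oo] --> x) /\
      forall n, `|x - rat_point R (r n)| < (H (r n))%:R `^ (- alpha)]].

Definition irr_exponent (R : realType) (d : nat) (H : 'rV[rat]_d -> nat) :
    \bar R :=
  ereal_inf [set irr_exponent_at H x | x in ~` range (@rat_point R d)].

(* Main.v *)
Require Import Defs.
From HB Require Import structures.
From mathcomp Require Import all_boot all_order all_algebra.
From mathcomp Require Import all_classical all_reals all_analysis.
From mathcomp Require Import zify ring lra.

(* A rational point close to [x] is built from best denominators [q_i] of the
   coordinates. At precision [exp (- t)] one can pass from [q_i] to a new best
   denominator [q_i'] with [ln q_i + ln q_i' <= t]. If all rational points near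
   [x] were far from [x] relative to their height, this passage would decrease
   forever a nonnegative potential by a fixed amount: [\sum_i (t - 2 ln q_i)^2]
   for the product, and the sum of the [ln (c / ln q_i)] with [c = max_i ln q_i]
   for the maximum. For the minimum, Dirichlet's theorem in one coordinate is
   enough.

   Conversely, the point with all coordinates [sqrt 2] is extremal for the
   minimum, for the product, and for the maximum if [d = 2]. For the maximum and
   [d >= 3], take coordinates whose convergents have denominators about
   [exp (4 lam^k)], the exponents [k] being distributed cyclically over the
   coordinates. The height is then critical just before the denominator of level
   [k + 1] becomes available, which gives the exponent [lam + lam^(1 - d)];
   its minimum over [lam] is attained at [lam^d = d - 1]. *)

Set Implicit Arguments.
Unset Strict Implicit.
Unset Printing Implicit Defensive.
Import Order.TTheory GRing.Theory Num.Theory.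
Import numFieldNormedType.Exports.

Local Open Scope classical_set_scope.
Local Open Scope ring_scope.

(** * Best denominators of one real number *)

Section nearest_integer.
Variable R : realType.
Implicit Types (x y : R) (q : nat).

Definition nint y : int := Num.floor (y + 1 / 2).

Definition int_dist x q : R := `|q%:R * x - (nint (q%:R * x))%:~R|.

Lemma nint_dist_le_half y : `|y - (nint y)%:~R| <= 1 / 2.
Proof.
have /andP[h1 h2] := floor_itv (y + 1 / 2).
by rewrite ler_norml /nint; move: h1 h2; rewrite intrD; lra.
Qed.

Lemma int_dist_le_half x q : int_dist x q <= 1 / 2.
Proof. exact: nint_dist_le_half. Qed.

Lemma nint_dist_le y (p : int) : `|y - (nint y)%:~R| <= `|y - p%:~R|.
Proof.
have [->//|pn] := eqVneq p (nint y).
have h : 1 <= `|(p - nint y)%:~R : R|.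
  by rewrite -intr_norm -[1]/(1%:~R) ler_int -gtz0_ge1 normr_gt0 subr_eq0.
have := nint_dist_le_half y.
have := ler_normB (y - (nint y)%:~R) (y - p%:~R).
have -> : y - (nint y)%:~R - (y - p%:~R) = (p - nint y)%:~R.
  by rewrite intrB; ring.
lra.
Qed.

(* The bound [(N + 1)^-1] rather than [N^-1] is what makes the product of two
   consecutive best denominators at most [1 / int_dist], with no constant. *)
Lemma dirichlet x (N : nat) : (0 < N)%N ->
  exists2 q, (0 < q <= N)%N & int_dist x q <= N.+1%:R^-1.
Proof.
move=> N0.
have M0 : 0 < N.+1%:R :> R by rewrite ltr0n.
pose fr (q : nat) : R := q%:R * x - (Num.floor (q%:R * x))%:~R.
have fr0 q : 0 <= fr q by rewrite subr_ge0 floor_le.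
have fr1 q : fr q < 1.
  by have := floorD1_gt (q%:R * x); rewrite /fr intrD; lra.
have boxlt q : (Num.truncn (N.+1%:R * fr q) < N.+1)%N.
  rewrite truncn_lt_nat; last by rewrite mulr_ge0 // ltW.
  by rewrite -[ltRHS]mulr1 ltr_pM2l.
pose box (q : 'I_N.+1) : 'I_N.+1 := Ordinal (boxlt q).
have boxP (q : 'I_N.+1) : (box q)%:R <= N.+1%:R * fr q < (box q)%:R + 1.
  by rewrite natr1; apply: truncn_itv; rewrite mulr_ge0 // ltW.
(* The multiples [0, ..., N] of [x] fall into [N + 1] boxes: either two share a box, or one lies in
   the last box, within [1 / (N + 1)] of the next integer. *)
have [/injectiveP inj|] := boolP (injectiveb box); last first.
  move=> /injectivePn[q1 [q2]].
  wlog lt12 : q1 q2 / (q1 < q2)%N.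
    move=> W neq beq; have [lt|lt|/val_inj e] := ltngtP q1 q2.
    - exact: W lt neq beq.
    - by apply: (W q2 q1) => //; rewrite eq_sym.
    - by rewrite e eqxx in neq.
  move=> _ beq; exists (q2 - q1)%N.
    by rewrite subn_gt0 lt12 (leq_trans (leq_subr _ _)) // -ltnS ltn_ord.
  apply: (le_trans (nint_dist_le _ (Num.floor (q2%:R * x) - Num.floor (q1%:R * x)))).
  rewrite natrB; last exact: ltnW.
  have -> : (q2%:R - q1%:R) * x -
      (Num.floor (q2%:R * x) - Num.floor (q1%:R * x))%:~R = fr q2 - fr q1.
    by rewrite intrB /fr; ring.
  have := boxP q1; have := boxP q2; rewrite -beq => /andP[h1 h2] /andP[h3 h4].
  rewrite -(ler_pM2l M0) divff ?gt_eqF // -[N.+1%:R]gtr0_norm // -normrM.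
  by rewrite ler_norml; lra.
have [g _ gK] := injF_bij inj.
set q := g ord_max; exists q; last first.
  have /andP[h _] := boxP q; rewrite gK /= in h.
  apply: (le_trans (nint_dist_le _ (Num.floor (q%:R * x) + 1))).
  have -> : q%:R * x - (Num.floor (q%:R * x) + 1)%:~R = fr q - 1.
    by rewrite intrD /fr; ring.
  rewrite ler0_norm; last by have := fr1 q; lra.
  rewrite -(ler_pM2l M0) divff ?gt_eqF //.
  by move: h; rewrite -natr1; lra.
have qN : (q <= N)%N by rewrite -ltnS ltn_ord.
rewrite qN andbT lt0n; apply/eqP => q0.
have : nat_of_ord (box q) = N by rewrite gK.
rewrite /= q0 /fr mul0r floor0 subrr mulr0 truncn0 => e.
by rewrite -e in N0.
Qed.

(** Best approximations of the second kind, ties allowed. *)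
Definition best_denom x q :=
  (0 < q)%N /\ forall q', (0 < q' <= q)%N -> int_dist x q <= int_dist x q'.

Lemma best_denom1 x : best_denom x 1.
Proof.
split=> // q' h; have -> // : q' = 1%N; lia.
Qed.

(** Dirichlet with [N] the integer part of the inverse distance gives a strictly closer denominator
    at most [N]; the least strictly closer one is again best. *)
Lemma best_denom_next x q : best_denom x q -> 0 < int_dist x q ->
  exists q', [/\ best_denom x q', (q < q')%N & q'%:R * int_dist x q <= 1].
Proof.
move=> [q0 bq] D0.
have V1 : 1 <= (int_dist x q)^-1.
  rewrite -[leLHS]invr1 lef_pV2 ?posrE //.
  by apply: (le_trans (int_dist_le_half _ _)); lra.
have N0 : (0 < Num.truncn (int_dist x q)^-1)%N by rewrite truncn_gt0.
have [qd /andP[qd0 qdN] qdD] := dirichlet x N0.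
have qdlt : int_dist x qd < int_dist x q.
  apply: (le_lt_trans qdD); rewrite -[ltRHS]invrK ltf_pV2 ?posrE ?ltr0n ?invr_gt0 //.
  exact: truncnS_gt.
have ex : exists n, (0 < n)%N && (int_dist x n < int_dist x q).
  by exists qd; rewrite qd0.
case: (ex_minnP ex) => m /andP[m0 mlt] mmin; exists m; split.
- split=> // q' /andP[q'0 q'm].
  have [->//|q'lt] := eqVneq q' m.
  have {}q'lt : (q' < m)%N by rewrite ltn_neqAle q'lt.
  apply: ltW; apply: (lt_le_trans mlt); rewrite leNgt; apply/negP => h.
  by have := mmin q'; rewrite q'0 h leqNgt q'lt => /(_ isT).
- rewrite ltnNge; apply/negP => mq.
  by have := bq m; rewrite m0 mq => /(_ isT); rewrite leNgt mlt.
- rewrite -ler_pdivlMr // mul1r.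
  have mle : (m <= qd)%N by apply: mmin; rewrite qd0 qdlt.
  apply: (@le_trans _ _ (Num.truncn (int_dist x q)^-1)%:R).
    by rewrite ler_nat (leq_trans mle).
  by rewrite truncn_le (le_trans _ V1).
Qed.

(** Iterates [best_denom_next]: as long as the distance exceeds [q * e], the next denominator [m]
    satisfies [q * m * e <= 1]. *)
Lemma best_denom_refine x q (e : R) : best_denom x q -> 0 < e ->
  exists q', [/\ best_denom x q', (q <= q')%N, int_dist x q' <= q'%:R * e
    & q' = q \/ q%:R * q'%:R * e <= 1].
Proof.
(* Distances are at most [1 / 2], so the iteration has stopped once [q] reaches [K > 1 / e]; [n]
   bounds the steps left. *)
move=> bq e0; pose K := (Num.truncn e^-1).+1.
have : (K <= q + K)%N by rewrite leq_addl.
move: {2}K => n; elim: n q bq => [|n IH] q bq Kq.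
  exists q; split; [by []|by []| |by left].
  apply: (@le_trans _ _ 1); first by have := int_dist_le_half x q; lra.
  rewrite addn0 in Kq; rewrite -ler_pdivrMr // mul1r ltW //.
  by apply: (lt_le_trans (truncnS_gt _)); rewrite ler_nat.
have [h|h] := leP (int_dist x q) (q%:R * e).
  by exists q; split => //; left.
have q0 : 0 < q%:R :> R by rewrite ltr0n; case: bq.
have D0 : 0 < int_dist x q by apply: le_lt_trans h; rewrite mulr_ge0 // ltW.
have [m [bm qm mD]] := best_denom_next bq D0.
have m0 : 0 < m%:R :> R by rewrite ltr0n; case: bm.
have key : q%:R * m%:R * e <= 1.
  apply: le_trans mD; rewrite -mulrA mulrCA ler_pM2l //; exact: ltW.
have [|m' [bm' mm' Dm' cs]] := IH m bm.
  by rewrite (leq_trans Kq) // addnS -addSn leq_add2r.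
exists m'; split => //; first exact: leq_trans (ltnW qm) mm'.
right; case: cs => [->//|cs].
apply: le_trans cs; rewrite -!mulrA ler_wpM2r //; last by rewrite ler_nat ltnW.
by rewrite mulr_ge0 // ltW.
Qed.

End nearest_integer.

(** * Criteria bounding the exponent of irrationality *)

Section exponent_bounds.
Variables (R : realType) (d : nat).
Implicit Types (H : 'rV[rat]_d -> nat) (x : 'rV[R]_d) (r : 'rV[rat]_d).

Lemma row_norm_le (v : 'rV[R]_d) (e : R) : 0 <= e ->
  (forall i, `|v ord0 i| <= e) -> `|v| <= e.
Proof.
move=> e0 h; rewrite [leLHS]mx_normrE; apply: bigmax_le => // -[i j] _ /=.
by rewrite (ord1 i).
Qed.

Lemma coord_norm_le (v : 'rV[R]_d) i : `|v ord0 i| <= `|v|.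
Proof.
rewrite [leRHS]mx_normrE.
exact: (le_bigmax (0 : R) (fun ij : 'I_1 * 'I_d => `|v ij.1 ij.2|) (ord0, i)).
Qed.

Lemma rat_point_coord_dist x r i :
  `|x ord0 i - ratr (r ord0 i)| <= `|x - rat_point R r|.
Proof. by have := coord_norm_le (x - rat_point R r) i; rewrite !mxE. Qed.

(** Exponents below [b] suffice for a supremum; letting [e] run through [1 / (n + 1)] produces the
    sequence. *)
Lemma irr_exponent_at_ge H x (b : R) :
  0 < b ->
  (forall a, 0 <= a < b -> forall e, 0 < e -> exists r,
     `|x - rat_point R r| < e /\ `|x - rat_point R r| < (H r)%:R `^ (- a)) ->
  (b%:E <= irr_exponent_at H x)%E.
Proof.
move=> b0 ap; apply/lee_subgt0Pr => e e0; rewrite -EFinB.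
pose a := Num.max 0 (b - e).
have ab : 0 <= a < b.
  by rewrite le_max lexx /= gt_max b0 /= ltrBlDr ltrDl.
apply: (@le_trans _ _ a%:E); first by rewrite lee_fin le_max lexx orbT.
have N0 n : 0 < n.+1%:R^-1 :> R by rewrite invr_gt0 ltr0n.
have [r rP] := choice (fun n => ap a ab _ (N0 n)).
apply: ereal_sup_ubound; exists a => //; split; first by case/andP: ab.
exists r; split; last by move=> n; case: (rP n).
apply/cvgrPdist_lt => _/posnumP[f].
near=> n; have [h _] := rP n; apply: (lt_trans h).
by near: n; exact: near_infty_natSinv_lt.
Unshelve. all: by end_near. Qed.

(** Along a sequence with exponent [a > b], [H ^ (a - b)] stays below [1 / c]; bounded heights keep
    the distance away from 0, against convergence. *)
Lemma irr_exponent_at_le H x (b c : R) :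
  0 <= b -> 0 < c -> (forall r, (0 < H r)%N) ->
  (forall r, c * (H r)%:R `^ (- b) <= `|x - rat_point R r|) ->
  (irr_exponent_at H x <= b%:E)%E.
Proof.
move=> b0 c0 H0 far; apply: ge_ereal_sup => _ [a [a0 [r [cv lt]]] <-].
rewrite lee_fin leNgt; apply/negP => ba.
have ab0 : 0 < a - b by rewrite subr_gt0.
pose B := c^-1 `^ (a - b)^-1.
have B0 : 0 < B by rewrite powR_gt0 ?invr_gt0.
have Hr0 n : 0 < (H (r n))%:R :> R by rewrite ltr0n.
have HB n : (H (r n))%:R <= B.
  have -> : (H (r n))%:R = ((H (r n))%:R `^ (a - b)) `^ (a - b)^-1 :> R.
    by rewrite -powRrM divff ?gt_eqF // powRr1 // ltW.
  apply: ge0_ler_powR; rewrite ?nnegrE ?powR_ge0 ?invr_ge0 ?(ltW ab0) ?(ltW c0) //.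
  have := le_lt_trans (far (r n)) (lt n).
  rewrite -ltr_pdivlMl // => h; rewrite -(@ler_pM2r _ ((H (r n))%:R `^ - a)); last first.
    exact: powR_gt0.
  rewrite -powRD; last by rewrite (gt_eqF (Hr0 n)) implybT.
  have -> : a - b - a = - b by ring.
  exact: ltW.
clearbody B.
have low n : c * B `^ (- b) <= `|x - rat_point R (r n)|.
  apply: le_trans (far (r n)); rewrite ler_pM2l // !powRN lef_pV2 ?posrE ?powR_gt0 //.
  by apply: ge0_ler_powR; rewrite ?nnegrE ?(ltW (Hr0 n)) ?(ltW B0).
have cB0 : 0 < c * B `^ (- b) by rewrite mulr_gt0 ?powR_gt0.
have /cvgrPdist_lt/(_ _ cB0) [N _ /(_ N (leqnn N))] := cv.
by rewrite ltNge low.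
Qed.

(** The positive lower bound also shows that [x] is not rational. *)
Lemma irr_exponent_le H x (b c : R) :
  0 <= b -> 0 < c -> (forall r, (0 < H r)%N) ->
  (forall r, c * (H r)%:R `^ (- b) <= `|x - rat_point R r|) ->
  (irr_exponent R H <= b%:E)%E.
Proof.
move=> b0 c0 H0 far; apply: ge_ereal_inf; exists (irr_exponent_at H x).
  exists x => // -[r _ xr]; have := far r.
  rewrite xr subrr normr0 leNgt mulr_gt0 ?powR_gt0 ?ltr0n //.
exact: irr_exponent_at_le far.
Qed.

End exponent_bounds.

(** * Denominators and the three heights *)

Section heights.
Variable d : nat.
Implicit Types (q : 'I_d -> nat) (r : 'rV[rat]_d).

Definition denom r (i : 'I_d) : nat := `|denq (r ord0 i)|%N.

Lemma denom_gt0 r i : (0 < denom r i)%N.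
Proof. by rewrite absz_gt0 denq_neq0. Qed.

Lemma denom_frac_le (p : int) (q : nat) : (0 < q)%N ->
  (`|denq (p%:~R / q%:R)| <= q)%N.
Proof.
move=> q0; have -> : p%:~R / q%:R = fracq (p, q%:Z) by rewrite fracqE.
rewrite den_fracq /= -lt0n q0 /=; exact: leq_div.
Qed.

Lemma leq_theta_max q i : (q i <= theta_max q)%N.
Proof. exact: leq_bigmax. Qed.

Lemma theta_max_attained q : (0 < d)%N -> exists i, theta_max q = q i.
Proof.
move=> d0; rewrite /theta_max; have [|i ->] := @bigop.eq_bigmax _ q; first by rewrite card_ord.
by exists i.
Qed.

Lemma theta_max_le q q' : (forall i, q i <= q' i)%N ->
  (theta_max q <= theta_max q')%N.
Proof.
move=> h; apply/bigmax_leqP => i _; exact: leq_trans (h i) (leq_theta_max _ _).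
Qed.

Lemma theta_min_le q i : (theta_min q <= q i)%N.
Proof.
rewrite /theta_min; have := mem_index_enum i.
elim: (index_enum _) => // j s IH; rewrite inE big_cons => /orP[/eqP<-|/IH].
  exact: geq_minl.
by move=> h; rewrite geq_min h orbT.
Qed.

Lemma theta_min_attained q : (0 < d)%N -> exists i, theta_min q = q i.
Proof.
(* The fold starts from the maximum, itself one of the [q i]. *)
move=> d0; rewrite /theta_min; have [i0 ->] := theta_max_attained q d0.
elim: (index_enum _) => [|j s [i IH]]; first by exists i0; rewrite big_nil.
rewrite big_cons IH /minn; case: ifP => _; by [exists j | exists i].
Qed.

Lemma theta_prod_le q q' : (forall i, q i <= q' i)%N ->
  (theta_prod q <= theta_prod q')%N.
Proof. by move=> h; apply: leq_prod. Qed.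

Lemma H_max_gt0 r : (0 < d)%N -> (0 < H_max r)%N.
Proof.
move=> d0; exact: leq_trans (denom_gt0 r (Ordinal d0)) (leq_theta_max _ _).
Qed.

Lemma H_min_gt0 r : (0 < d)%N -> (0 < H_min r)%N.
Proof.
by move=> d0; have [i e] := theta_min_attained (denom r) d0; rewrite [H_min r]e denom_gt0.
Qed.

Lemma H_prod_gt0 r : (0 < H_prod r)%N.
Proof. by rewrite prodn_gt0 // => i; exact: denom_gt0. Qed.

End heights.

(** * Descent and logarithmic inequalities *)

Lemma no_infinite_descent (R : realType) (T : Type) (P : T -> Prop)
    (Phi : T -> R) (eta : R) :
  0 < eta -> (forall s, P s -> 0 <= Phi s) ->
  (forall s, P s -> exists2 s', P s' & Phi s' <= Phi s - eta) ->
  forall s, ~ P s.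
Proof.
move=> eta0 Phi0 step s Ps.
have H n : forall s, P s -> Phi s < n%:R * eta -> False.
  elim: n => [|n IH] {Ps}s Ps lt.
    by have := Phi0 s Ps; rewrite leNgt mul0r in lt *; rewrite lt.
  have [s' Ps' le] := step s Ps; apply: (IH s' Ps').
  by move: lt; rewrite -natr1; lra.
apply: (H (Num.truncn (Phi s / eta)).+1 s Ps).
by rewrite -ltr_pdivrMr // truncnS_gt.
Qed.

Lemma ln_natr_prod (R : realType) (d : nat) (q : 'I_d -> nat) :
  (forall i, 0 < q i)%N ->
  ln (\prod_(i < d) q i)%:R = \sum_(i < d) ln (q i)%:R :> R.
Proof.
move=> q0; rewrite natr_prod -[RHS]expRK expR_sum; congr ln.
by apply: eq_bigr => i _; rewrite lnK // posrE ltr0n.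
Qed.

(** Weighted AM-GM for [u / (N - 1)] with weight [N - 1] and [v] with weight 1, from [ln y <= y - 1]
    at their ratios to the mean [m]. *)
Lemma ln_AGM (R : realType) (N u v : R) : 1 < N -> 0 < u -> 0 < v ->
  (N - 1) * ln u + ln v + (N * ln N - (N - 1) * ln (N - 1)) <= N * ln (u + v).
Proof.
move=> N1 u0 v0.
have n0 : 0 < N - 1 by lra.
have N0 : 0 < N by lra.
pose m := (u + v) / N.
have m0 : 0 < m by rewrite divr_gt0 // addr_gt0.
have lnB1 (y : R) : 0 < y -> ln y <= y - 1.
  by move=> y0; have := @le_ln1Dx R (y - 1); rewrite subrKC; apply; lra.
have h1 := @lnB1 (u / (N - 1) / m) (divr_gt0 (divr_gt0 u0 n0) m0).
have h2 := @lnB1 (v / m) (divr_gt0 v0 m0).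
have uv0 : 0 < u + v by rewrite addr_gt0.
rewrite !ln_div ?posrE ?divr_gt0 // in h1 h2.
rewrite -(ler_pM2l n0) in h1.
have e : (N - 1) * (u / (N - 1) / m - 1) + (v / m - 1) = 0.
  rewrite /m; field; apply/and3P; split; rewrite gt_eqF //; lra.
lra.
Qed.

(** * Simultaneous approximation at a given precision *)

Section simultaneous_best_approximation.
Variables (R : realType) (d : nat) (x : 'rV[R]_d).
Implicit Types (q : 'I_d -> nat) (t : R).

(** Divided by [q i], the inequality puts the nearest fraction with denominator [q i] within
    [expR (- t)] of the coordinate. *)
Definition best_at t q := forall i, best_denom (x ord0 i) (q i) /\
  int_dist (x ord0 i) (q i) <= (q i)%:R * expR (- t).

Definition nearest_point q : 'rV[rat]_d :=
  \row_i ((nint ((q i)%:R * x ord0 i))%:~R / (q i)%:R).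

Lemma best_at_gt0 t q i : best_at t q -> (0 < q i)%N.
Proof. by move=> /(_ i)[[]]. Qed.

Lemma ln_denom_ge0 t q i : best_at t q -> 0 <= ln (q i)%:R :> R.
Proof. by move=> /(best_at_gt0 i) q0; rewrite ln_ge0 // ler1n. Qed.

Lemma best_at_refine q t : (forall i, best_denom (x ord0 i) (q i)) ->
  exists2 q', best_at t q' & forall i, (q i <= q' i)%N /\
    (q' i = q i \/ ln (q i)%:R + ln (q' i)%:R <= t).
Proof.
move=> bq.
have [q' q'P] := choice (fun i => best_denom_refine (bq i) (expR_gt0 (- t))).
exists q' => i; case: (q'P i) => b le D cs; split => //.
case: cs => [->|cs]; [by left|right].
have q0 : 0 < (q i)%:R :> R by rewrite ltr0n; case: (bq i).
have q'0 : 0 < (q' i)%:R :> R by rewrite ltr0n; case: b.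
rewrite -lnM ?posrE // -[leRHS]expRK ler_ln ?posrE ?mulr_gt0 ?expR_gt0 //.
by move: cs; rewrite expRN ler_pdivrMr ?expR_gt0 // mul1r.
Qed.

Lemma best_at_exists t : exists q, best_at t q.
Proof.
have [q bq _] := best_at_refine t (fun i => best_denom1 (x ord0 i)).
by exists q.
Qed.

Lemma nearest_point_dist t q : best_at t q ->
  `|x - rat_point R (nearest_point q)| <= expR (- t).
Proof.
move=> bq; apply: row_norm_le => [|i]; first exact: expR_ge0.
have q0 : 0 < (q i)%:R :> R by rewrite ltr0n (best_at_gt0 _ bq).
rewrite !mxE fmorph_div /= ratr_int ratr_nat -(ler_pM2l q0).
have [_] := bq i; apply: le_trans; rewrite -[X in X * _]gtr0_norm // -normrM.
by rewrite mulrBr [_ * (_ / _)]mulrCA divff ?gt_eqF // mulr1.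
Qed.

Lemma nearest_point_denom t q i : best_at t q ->
  (denom (nearest_point q) i <= q i)%N.
Proof.
by move=> bq; rewrite /denom mxE denom_frac_le // (best_at_gt0 _ bq).
Qed.

(** The nearest point is within [e] of [x], hence far relative to its height, which is at most
    [Theta q] because reducing fractions only lowers denominators. *)
Lemma best_at_height (Theta : ('I_d -> nat) -> nat) (a e t : R) q :
  (forall q q', (forall i, q i <= q' i)%N -> (Theta q <= Theta q')%N) ->
  (forall r, 0 < height Theta r)%N ->
  (forall r, `|x - rat_point R r| < e ->
     (height Theta r)%:R `^ (- a) <= `|x - rat_point R r|) ->
  0 <= a -> expR (- t) < e -> best_at t q -> t <= a * ln (Theta q)%:R.
Proof.
move=> mono H0 far a0 te bq; have le := nearest_point_dist bq.
have le2 := le_trans (far _ (le_lt_trans le te)) le.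
have hle : (height Theta (nearest_point q) <= Theta q)%N.
  by apply: mono => i; exact: nearest_point_denom bq.
have h0 : 0 < (height Theta (nearest_point q))%:R :> R by rewrite ltr0n.
have T0 : 0 < (Theta q)%:R :> R by rewrite ltr0n (leq_trans (H0 _) hle).
rewrite -ler_ln ?posrE ?powR_gt0 ?expR_gt0 // ln_powR expRK mulNr lerN2 in le2.
apply: (le_trans le2); rewrite ler_wpM2l // ler_ln ?posrE // ler_nat //.
Qed.

End simultaneous_best_approximation.

(** * Lower bound for the product *)

(* In logarithmic time [t] the potential [\sum_i (t - 2 ln q_i)^2] does not
   increase when some [q_i] is replaced by [q_i'] with
   [ln q_i + ln q_i' <= t]; while the [q_i] stay fixed its derivative
   [2 \sum_i (t - 2 ln q_i)] is negative as long as the height stays large. *)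
Lemma H_prod_approx (R : realType) (d : nat) (x : 'rV[R]_d) (a e : R) :
  (0 < d)%N -> 0 <= a < 2 / d%:R -> 0 < e ->
  exists r, `|x - rat_point R r| < e /\
    `|x - rat_point R r| < (H_prod r)%:R `^ (- a).
Proof.
move=> d0 /andP[a0 ad] e0; apply: contrapT => nex.
have far r : `|x - rat_point R r| < e ->
    (height (@theta_prod d) r)%:R `^ (- a) <= `|x - rat_point R r|.
  by move=> h; rewrite leNgt; apply/negP => h2; apply: nex; exists r.
have D1 : 1 <= d%:R :> R by rewrite ler1n.
have D0 : 0 < d%:R :> R by rewrite ltr0n.
pose eta := 2 - a * d%:R.
have eta0 : 0 < eta by rewrite subr_gt0 -ltr_pdivlMr.
have a2 : a <= 2 by apply: ltW; apply: (lt_le_trans ad); rewrite ler_pdivrMr // ; lra.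
(* The first term gives [expR (- t) < e], the second [d + 1 <= eta * t]. *)
pose t0 := Num.max (1 - ln e) ((d%:R + 1) / eta).
have t0e : 1 - ln e <= t0 by rewrite le_max lexx.
have t0d : (d%:R + 1) / eta <= t0 by rewrite le_max lexx orbT.
have t00 : 0 < t0 by apply: lt_le_trans t0d; rewrite divr_gt0 // ; lra.
have te t : t0 <= t -> expR (- t) < e.
  by move=> h; rewrite -[ltRHS]lnK ?posrE // ltr_expR; lra.
have [q bq] := best_at_exists x t0.
pose P (s : R * ('I_d -> nat)) := t0 <= s.1 /\ best_at x s.1 s.2.
pose Phi (s : R * ('I_d -> nat)) : R := \sum_(i < d) (s.1 - 2 * ln (s.2 i)%:R) ^+ 2.
have Phi0 s : P s -> 0 <= Phi s by move=> _; apply: sumr_ge0 => i _; exact: sqr_ge0.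
apply: (no_infinite_descent ltr01 Phi0 _ (s := (t0, q))); last by split.
move=> {q bq}[t q] [/= tt0 bq].
have [q' bq' cs] := best_at_refine (t + 1) (fun i => (bq i).1).
exists (t + 1, q'); first by split => //=; lra.
rewrite /Phi /=.
pose S : R := \sum_(i < d) ln (q i)%:R.
have tS : t <= a * S.
  have := best_at_height (@theta_prod_le d) (@H_prod_gt0 d) far a0 (te _ tt0) bq.
  by rewrite ln_natr_prod // => i; exact: best_at_gt0 bq.
(* The right side is [(t + 1 - 2 u) ^ 2]; if [q i] changes, [u <= v] and [u + v <= t + 1] give
   [|t + 1 - 2 v| <= t + 1 - 2 u]. *)
have le i : (t + 1 - 2 * ln (q' i)%:R) ^+ 2 <=
    (t - 2 * ln (q i)%:R) ^+ 2 + (2 * t + 1) - 4 * ln (q i)%:R :> R.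
  case: (cs i) => qq' [->|h]; first by rewrite le_eqVlt; apply/orP; left; apply/eqP; ring.
  have : ln (q i)%:R <= ln (q' i)%:R :> R.
    by rewrite ler_ln ?posrE ?ltr0n ?(best_at_gt0 _ bq) ?(best_at_gt0 _ bq') ?ler_nat.
  move: h; set u := ln (q i)%:R; set v := ln (q' i)%:R => h1 h2; nra.
apply: (le_trans (ler_sum _ (fun i _ => le i))).
rewrite sumrB big_split /= sumr_const card_ord -mulr_sumr -/S -[_ *+ d]mulr_natl.
have S0 : 0 <= S by apply: sumr_ge0 => i _; exact: ln_denom_ge0 bq.
(* The total change is at most [d * (2 t + 1) - 4 S <= d - 2 eta S <= d - eta t <= -1]. *)
have h1 : d%:R * t <= d%:R * (a * S) by rewrite ler_pM2l.
have h2 : t <= 2 * S by apply: (le_trans tS); rewrite ler_wpM2r.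
have h3 : d%:R + 1 <= eta * t.
  by rewrite mulrC -ler_pdivrMr //; apply: le_trans tt0.
have h4 : eta * t <= eta * (2 * S) by rewrite ler_pM2l.
have h5 : eta * S = 2 * S - d%:R * (a * S) by rewrite /eta; ring.
lra.
Qed.

(** * Lower bound for the maximum *)

Section H_max_lower_bound.
Variables (R : realType) (d : nat) (d2 : (2 <= d)%N).

Definition max_exponent : R := d%:R / (d%:R - 1) `^ ((d%:R - 1) / d%:R).

Lemma pred_d_ge1 : 1 <= d%:R - 1 :> R.
Proof. by rewrite lerBrDr (ler_nat _ 2). Qed.

Lemma max_exponent_gt0 : 0 < max_exponent.
Proof.
have := pred_d_ge1 => h.
by rewrite divr_gt0 ?powR_gt0 ?ltr0n //; [lia | lra].
Qed.

(** The right side is the constant of [ln_AGM] at [N = d]. *)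
Lemma ln_max_exponent :
  d%:R * ln max_exponent = d%:R * ln d%:R - (d%:R - 1) * ln (d%:R - 1).
Proof.
have h := pred_d_ge1.
have D0 : 0 < d%:R :> R by rewrite ltr0n; lia.
rewrite /max_exponent ln_div ?posrE ?powR_gt0 ?ln_powR //; last by lra.
by field; rewrite gt_eqF.
Qed.

Lemma max_exponent_le : max_exponent <= d%:R.
Proof.
have h := pred_d_ge1.
have D0 : 0 < d%:R :> R by rewrite ltr0n; lia.
rewrite -ler_ln ?posrE ?max_exponent_gt0 // -(ler_pM2l D0) ln_max_exponent.
by rewrite gerBl mulr_ge0 ?ln_ge0 //; lra.
Qed.

(* The potential is [\sum_i (ln (1 + c) - ln (1 + ln q_i))] where
   [c = max_i ln q_i]. When the time comes at which the current height no longer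
   suffices, the coordinate [i] carrying the new maximum [c'] satisfies
   [c' + ln q_i <= a c + 1], and the weighted AM-GM inequality turns this into
   a decrease of the potential by a constant. *)
Lemma H_max_approx (x : 'rV[R]_d) (a e : R) :
  0 <= a < max_exponent -> 0 < e ->
  exists r, `|x - rat_point R r| < e /\
    `|x - rat_point R r| < (H_max r)%:R `^ (- a).
Proof.
move=> /andP[a0 am] e0; apply: contrapT => nex.
have far r : `|x - rat_point R r| < e ->
    (height (@theta_max d) r)%:R `^ (- a) <= `|x - rat_point R r|.
  by move=> h; rewrite leNgt; apply/negP => h2; apply: nex; exists r.
have d0 : (0 < d)%N by lia.
have D0 : 0 < d%:R :> R by rewrite ltr0n.
have D1 := pred_d_ge1.
(* The slack [w - a] absorbs additive constants: [(w - a) * c >= 3] once [c >= c0]. *)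
pose w := (a + max_exponent) / 2.
have aw : 0 < w - a by rewrite /w; lra.
have wm : w < max_exponent by rewrite /w; lra.
have w0 : 0 < w by lra.
pose c0 := 3 / (w - a).
have c00 : 0 < c0 by rewrite divr_gt0 //; lra.
(* The second term forces [c q >= c0], since [t <= a * c q <= d * c q]. *)
pose t0 := Num.max (1 - ln e) (d%:R * c0).
have t0e : 1 - ln e <= t0 by rewrite le_max lexx.
have t0d : d%:R * c0 <= t0 by rewrite le_max lexx orbT.
have te t : t0 <= t -> expR (- t) < e.
  by move=> h; rewrite -[ltRHS]lnK ?posrE // ltr_expR; lra.
have [q bq] := best_at_exists x t0.
pose c (q : 'I_d -> nat) : R := ln (theta_max q)%:R.
have qc t (q1 : 'I_d -> nat) i : best_at x t q1 -> ln (q1 i)%:R <= c q1.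
  move=> b; have q0 := best_at_gt0 i b.
  rewrite /c ler_ln ?posrE ?ltr0n ?ler_nat ?leq_theta_max //.
  exact: leq_trans q0 (leq_theta_max _ _).
pose P (s : R * ('I_d -> nat)) := t0 <= s.1 /\ best_at x s.1 s.2.
pose Phi (s : R * ('I_d -> nat)) : R :=
  \sum_(i < d) (ln (1 + c s.2) - ln (1 + ln (s.2 i)%:R)).
have Phi0 s : P s -> 0 <= Phi s.
  move=> [_ b]; apply: sumr_ge0 => i _; rewrite subr_ge0.
  have h := ln_denom_ge0 i b; have h2 := qc _ _ i b.
  by rewrite ler_ln ?posrE; lra.
pose eta := d%:R * (ln max_exponent - ln w).
have eta0 : 0 < eta.
  by rewrite mulr_gt0 // subr_gt0 ltr_ln ?posrE ?max_exponent_gt0.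
apply: (no_infinite_descent eta0 Phi0 _ (s := (t0, q))); last by split.
move=> {q bq}[t q] [/= tt0 bq].
have tc := best_at_height (@theta_max_le d) (fun r => H_max_gt0 r d0) far a0
  (te _ tt0) bq; rewrite -/(c q) in tc.
have cq0 : 0 <= c q.
  by apply: le_trans (qc _ _ (Ordinal d0) bq); exact: ln_denom_ge0 bq.
have cqc0 : c0 <= c q.
  rewrite -(ler_pM2l D0); apply: (le_trans t0d); apply: (le_trans tt0).
  apply: (le_trans tc); rewrite ler_wpM2r //.
  by apply: ltW; apply: (lt_le_trans am); exact: max_exponent_le.
(* By [tc], the current height can serve only up to time [a * c q]; at [t'] the maximum must have
   grown. *)
pose t' := a * c q + 1.
have tt' : t0 <= t' by rewrite /t'; lra.
have [q' bq' cs] := best_at_refine t' (fun i => (bq i).1).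
exists (t', q'); first by split.
have tc' := best_at_height (@theta_max_le d) (fun r => H_max_gt0 r d0) far a0
  (te _ tt') bq'; rewrite -/(c q') in tc'.
have cc' : c q < c q'.
  rewrite ltNge; apply/negP => h.
  by have := ler_wpM2l a0 h; rewrite /t' in tc'; lra.
have [i ei] := theta_max_attained q' d0.
have ci : c q' = ln (q' i)%:R by rewrite /c ei.
have qi0 := ln_denom_ge0 i bq.
have sumle : ln (q i)%:R + c q' <= t'.
  case: (cs i) => _ [eq|]; last by rewrite ci.
  by have := qc _ _ i bq; rewrite -eq -ci; lra.
have agm := @ln_AGM R d%:R (1 + c q') (1 + ln (q i)%:R).
rewrite -ln_max_exponent in agm.
have {}agm := agm ltac:(lra) ltac:(lra) ltac:(lra).
have up : ln (1 + c q' + (1 + ln (q i)%:R)) <= ln w + ln (1 + c q).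
  rewrite -lnM ?posrE ?ler_ln ?posrE ?mulr_gt0 //; try lra.
  have : 3 <= (w - a) * c q by rewrite mulrC -ler_pdivrMr.
  by move: sumle; rewrite /t'; lra.
rewrite -(ler_pM2l D0) in up.
have le j : ln (1 + ln (q j)%:R) <= ln (1 + ln (q' j)%:R) :> R.
  have h := ln_denom_ge0 j bq; have h' := ln_denom_ge0 j bq'.
  rewrite ler_ln ?posrE ?lerD2l ?ler_ln ?posrE ?ltr0n ?ler_nat //; try lra.
  - by case: (cs j).
  - exact: best_at_gt0 bq.
  - exact: best_at_gt0 bq'.
have sums : ln (1 + c q') + \sum_(j < d) ln (1 + ln (q j)%:R) <=
    ln (1 + ln (q i)%:R) + \sum_(j < d) ln (1 + ln (q' j)%:R) :> R.
  rewrite (bigD1 i) //= [in leRHS](bigD1 i) //= -ci.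
  have := @ler_sum R _ (index_enum 'I_d) (fun j => j != i) _ _ (fun j _ => le j).
  lra.
have sumBc (u : R) (f : 'I_d -> R) : \sum_(j < d) (u - f j) = d%:R * u - \sum_j f j.
  by rewrite sumrB sumr_const card_ord mulr_natl.
(* By [sums], [Phi] grows by at most [(d - 1) ln (1 + c') + ln (1 + ln q_i) - d ln (1 + c)]; [agm]
   and [up] bound this by [- eta]. *)
rewrite /Phi /= !sumBc /eta.
lra.
Qed.

End H_max_lower_bound.

(** * Lower bound for the minimum *)

Lemma H_min_approx (R : realType) (d : nat) (x : 'rV[R]_d) (a e : R) :
  (0 < d)%N -> 0 <= a < 2 -> 0 < e ->
  exists r, `|x - rat_point R r| < e /\
    `|x - rat_point R r| < (H_min r)%:R `^ (- a).
Proof.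
move=> d0 /andP[a0 a2] e0; pose i0 := Ordinal d0.
pose N := (Num.truncn e^-1).+1.
have [q /andP[q0 qN] qD] := @dirichlet R (x ord0 i0) N isT.
have Q0 : 0 < q%:R :> R by rewrite ltr0n.
have Q1 : 1 <= q%:R :> R by rewrite ler1n.
(* Dirichlet reaches this precision in coordinate [i0], and density in the others, whatever their
   denominators; it suffices as the minimum is at most [q] and [a < 2]. *)
pose f := Num.min e (q%:R ^- 2).
have f0 : 0 < f by rewrite lt_min e0 invr_gt0 exprn_gt0.
have den y : exists r : rat, `|y - ratr r| < f.
  have [|r] := @rat_in_itvoo R (y - f) (y + f); first by lra.
  by rewrite in_itv /= => /andP[h1 h2]; exists r; rewrite ltr_norml; lra.
have [s sP] := choice den.
pose p := nint (q%:R * x ord0 i0).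
pose r : 'rV[rat]_d := \row_i if i == i0 then p%:~R / q%:R else s (x ord0 i).
have i0f : `|x ord0 i0 - p%:~R / q%:R| < f.
  rewrite -(ltr_pM2l Q0) -[X in X * `|_|]gtr0_norm // -normrM.
  rewrite mulrBr [_ * (_ / _)]mulrCA divff ?gt_eqF // mulr1.
  apply: (le_lt_trans qD).
  have NN : N.+1%:R^-1 < N%:R^-1 :> R by rewrite ltf_pV2 ?posrE ?ltr0n ?ltr_nat.
  apply: (lt_le_trans NN); rewrite /f minr_pMr ?(ltW Q0) // le_min; apply/andP; split.
    apply: (@le_trans _ _ e); last by rewrite ler_peMl // ltW.
    rewrite -[leRHS]invrK lef_pV2 ?posrE ?ltr0n ?invr_gt0 //.
    by apply: ltW; exact: truncnS_gt.
  rewrite -exprVn expr2 mulrA divff ?gt_eqF // mul1r.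
  by rewrite lef_pV2 ?posrE ?ltr0n ?ler_nat.
have rf : `|x - rat_point R r| < f.
  have [->|] := eqVneq `|x - rat_point R r| 0; first by [].
  move=> /mx_norm_neq0[[i j] E]; rewrite [ltLHS]E /= !mxE (ord1 i).
  case: eqP => [->|_]; last exact: sP.
  by rewrite fmorph_div /= ratr_int ratr_nat.
exists r; split; first by apply: (lt_le_trans rf); rewrite ge_min lexx.
apply: (lt_le_trans rf); apply: (@le_trans _ _ (q%:R ^- 2)).
  by rewrite ge_min lexx orbT.
have H0 : 0 < (H_min r)%:R :> R by rewrite ltr0n H_min_gt0.
rewrite powRN lef_pV2 ?posrE ?powR_gt0 ?exprn_gt0 //.
rewrite -powR_mulrn; last exact: ltW.
apply: (@le_trans _ _ (q%:R `^ a)); last by apply: ler_powR => //; exact: ltW.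
apply: ge0_ler_powR; rewrite ?nnegrE ?(ltW H0) ?(ltW Q0) // ler_nat.
apply: (leq_trans (theta_min_le _ i0)).
by rewrite mxE eqxx denom_frac_le.
Qed.

(** * The point with all coordinates [sqrt 2] *)

Section quadratic_irrational.

(** The 2-adic valuation is even on the left and odd on the right. *)
Lemma sqr_neq_double_sqr (n m : nat) : (0 < m)%N -> (n ^ 2 != 2 * m ^ 2)%N.
Proof.
move=> m0; apply/eqP => e.
have n0 : (0 < n)%N by rewrite lt0n; apply/eqP => n0; rewrite n0 in e; nia.
have := congr1 (logn 2) e.
rewrite lognX lognM ?expn_gt0 ?m0 // lognX (@logn_prime 2 2) //=; lia.
Qed.

Variable R : realType.

(** For [r = p / m], the nonzero integer [p ^ 2 - 2 m ^ 2] is [m ^ 2] times [y - r] times its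
    conjugate factor, which is at most 4 near [y]. *)
Lemma sqrt2_badly_approximable (r : rat) :
  4^-1 * (`|denq r|%N)%:R ^- 2 <= `|Num.sqrt 2 - ratr r| :> R.
Proof.
set y : R := Num.sqrt 2.
have y2 : y ^+ 2 = 2 by rewrite sqr_sqrtr.
have y0 : 0 <= y by exact: sqrtr_ge0.
have y32 : y <= 3 / 2 by nra.
pose m : R := (`|denq r|%N)%:R.
have m0 : 0 < m by rewrite ltr0n absz_gt0 denq_neq0.
have m1 : 1 <= m by rewrite ler1n absz_gt0 denq_neq0.
have mE : (denq r)%:~R = m.
  by rewrite /m natr_absz gtr0_norm.
pose p : R := (numq r)%:~R.
have rE : ratr r = p / m by rewrite /ratr mE.
have big : 1 <= `|p ^+ 2 - 2 * m ^+ 2|.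
  have -> : p ^+ 2 - 2 * m ^+ 2 = (numq r ^+ 2 - 2 * denq r ^+ 2)%:~R.
    by rewrite intrB intrM !rmorphXn /= mE.
  rewrite -intr_norm -[1]/(1%:~R) ler_int -gtz0_ge1 normr_gt0 subr_eq0.
  apply/eqP => /(congr1 absz); rewrite abszM !abszX => /eqP.
  by apply/negP; apply: sqr_neq_double_sqr; rewrite absz_gt0 denq_neq0.
rewrite leNgt; apply/negP; rewrite -/m rE => lt.
have V1 : m ^- 2 <= 1 by rewrite invf_le1 ?exprn_gt0 // exprn_ege1.
have V0 : 0 < m ^- 2 by rewrite invr_gt0 exprn_gt0.
have : `|p ^+ 2 - 2 * m ^+ 2| < 1.
  have -> : p ^+ 2 - 2 * m ^+ 2 = m ^+ 2 * ((y - p / m) * ((y - p / m) - 2 * y)).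
    by rewrite -[in LHS]y2; field; rewrite gt_eqF.
  rewrite normrM ger0_norm ?exprn_ge0 ?(ltW m0) //.
  rewrite -ltr_pdivlMl ?exprn_gt0 // mulr1 normrM.
  have h : `|y - p / m - 2 * y| <= 4.
    by move: lt; rewrite ltr_norml => /andP[h1 h2]; rewrite ler_norml; lra.
  have := normr_ge0 (y - p / m); have := normr_ge0 (y - p / m - 2 * y).
  by move: lt h; nra.
by rewrite ltNge big.
Qed.

Variables (d : nat) (d0 : (0 < d)%N).

Definition sqrt2_row : 'rV[R]_d := const_mx (Num.sqrt 2).

Lemma sqrt2_row_H_min (r : 'rV[rat]_d) :
  4^-1 * (H_min r)%:R `^ (- 2) <= `|sqrt2_row - rat_point R r|.
Proof.
have [i e] := theta_min_attained (denom r) d0.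
have -> : H_min r = denom r i by [].
rewrite powRN powR_mulrn //.
apply: (le_trans (sqrt2_badly_approximable _)).
by have := rat_point_coord_dist sqrt2_row r i; rewrite mxE.
Qed.

Lemma sqrt2_row_H_max (r : 'rV[rat]_d) :
  4^-1 * (H_max r)%:R `^ (- 2) <= `|sqrt2_row - rat_point R r|.
Proof.
apply: le_trans (sqrt2_row_H_min r); rewrite ler_pM2l ?invr_gt0 //.
rewrite !powRN lef_pV2 ?posrE ?powR_gt0 ?ltr0n ?H_min_gt0 ?H_max_gt0 //.
apply: ge0_ler_powR; rewrite ?nnegrE ?ler0n // ler_nat.
exact: leq_trans (theta_min_le _ (Ordinal d0)) (leq_theta_max _ _).
Qed.

(** Reduces to the minimum, whose [d]-th power is at most the product. *)
Lemma sqrt2_row_H_prod (r : 'rV[rat]_d) :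
  4^-1 * (H_prod r)%:R `^ (- (2 / d%:R)) <= `|sqrt2_row - rat_point R r|.
Proof.
apply: le_trans (sqrt2_row_H_min r); rewrite ler_pM2l ?invr_gt0 //.
rewrite !powRN lef_pV2 ?posrE ?powR_gt0 ?ltr0n ?H_min_gt0 ?H_prod_gt0 //.
have -> : 2 = d%:R * (2 / d%:R) :> R by field; rewrite pnatr_eq0 -lt0n.
rewrite powRrM powR_mulrn //.
have -> : d%:R * (2 / d%:R) / d%:R = 2 / d%:R :> R by field; rewrite pnatr_eq0 -lt0n.
apply: ge0_ler_powR; rewrite ?nnegrE ?divr_ge0 ?ler0n // -natrX ler_nat.
rewrite -[X in (_ ^ X)%N](card_ord d) -prod_nat_const.
by apply: leq_prod => i _; exact: theta_min_le.
Qed.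

End quadratic_irrational.

(** * Numbers with prescribed convergent denominators *)

Section prescribed_denominators.
Variables (R : realType) (E : nat -> R).
Hypotheses (E0 : 1 <= E 0%N) (E4 : forall n, 4 * E n <= E n.+1).

Lemma scale_ge1 n : 1 <= E n.
Proof. by elim: n => // n IH; have := E4 n; lra. Qed.

(* Convergents of a continued fraction with minus signs: the partial quotient
   [a] makes the new denominator [a * q - q'] land in [E, E + q[. *)
Lemma unimodular_sequence : exists p q : nat -> int,
  (forall n, E n <= (q n)%:~R <= 2 * E n) /\
  (forall n, p n.+1 * q n - p n * q n.+1 = 1).
Proof.
pose step (n : nat) (s : int * int * (int * int)) : int * int * (int * int) :=
  let: (p', q', (p, q)) := s in
  let a := Num.ceil ((E n.+1 + q'%:~R) / q%:~R) in
  (p, q, (a * p - p', a * q - q')).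
pose s := fix s n := if n is n'.+1 then step n' (s n')
  else (0, -1, (-1, Num.ceil (E 0%N))) : int * int * (int * int).
pose inv n (t : int * int * (int * int)) :=
  (E n <= t.2.2%:~R <= 2 * E n) /\ t.2.1 * t.1.2 - t.1.1 * t.2.2 = 1.
have invs n : inv n (s n).
  elim: n => [|n].
    rewrite /inv /=; split; last by ring.
    have := ceil_ge (E 0%N); have := ceilB1_lt (E 0%N).
    rewrite intrB; move: (E 0%N) E0 (Num.ceil _)%:~R => e e1 z h1 h2.
    by apply/andP; split; lra.
  rewrite /=; case: (s n) => [[p' q'] [p q]] [/= /andP[q1 q2] det].
  rewrite /inv /=; set a := Num.ceil _; split; last by rewrite -det; ring.
  (* Since [q <= 2 E n <= E n.+1], the interval [[E n.+1, E n.+1 + q[] lies below [2 E n.+1]. *)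
  have En := scale_ge1 n; have En4 := E4 n.
  have q0 : 0 < q%:~R :> R by lra.
  have h1 : (E n.+1 + q'%:~R) / q%:~R <= a%:~R by exact: ceil_ge.
  have h2 : a%:~R - 1 < (E n.+1 + q'%:~R) / q%:~R.
    by have := ceilB1_lt ((E n.+1 + q'%:~R) / q%:~R); rewrite intrB.
  rewrite ler_pdivrMr // in h1; rewrite ltr_pdivlMr // in h2.
  by rewrite intrB intrM; apply/andP; split; lra.
exists (fun n => (s n).2.1), (fun n => (s n).2.2); split => n.
  by have [] := invs n.
have [_] := invs n.+1; rewrite /=; case: (s n) => [[p' q'] [p q]] /=.
by [].
Qed.

(** With [x] the limit of the increasing convergents [c n], a rational this close to [x] differs
    from [c n], as [x >= c n.+1]. Its distance to [c n] is then at least [1 / (D * Q n)] and less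
    than [3 / (Q n * Q n.+1)]. *)
Lemma lacunary_number : exists x : R, forall n (r : rat),
  `|x - ratr r| < (4 * E n * E n.+1)^-1 -> E n.+1 <= 3 * (`|denq r|%N)%:R.
Proof.
have [p [q [qE det]]] := unimodular_sequence.
have E1 := scale_ge1.
pose Q n : R := (q n)%:~R.
have Q1 n : 1 <= Q n by have /andP[h _] := qE n; exact: le_trans (E1 n) h.
have Q0 n : 0 < Q n by apply: lt_le_trans (Q1 n).
have QQ0 n : 0 < Q n * Q n.+1 by rewrite mulr_gt0.
pose c n : R := (p n)%:~R / Q n.
have cS n : c n.+1 = c n + (Q n * Q n.+1)^-1.
  have := congr1 (fun z : int => z%:~R : R) (det n).
  rewrite intrB !intrM -/(Q n) -/(Q n.+1) => e.
  rewrite /c; apply/eqP; rewrite -subr_eq0; apply/eqP.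
  transitivity (((p n.+1)%:~R * Q n - (p n)%:~R * Q n.+1 - 1) / (Q n * Q n.+1)).
    by field; rewrite (gt_eqF (Q0 n)) (gt_eqF (Q0 n.+1)).
  by rewrite e subrr mul0r.
have c_nd m n : (m <= n)%N -> c m <= c n.
  elim: n => [|n IH]; first by rewrite leqn0 => /eqP->.
  rewrite leq_eqVlt => /orP[/eqP->//|/IH h]; apply: (le_trans h).
  by rewrite cS lerDl invr_ge0 ltW.
pose u n : R := c n + 2 / (Q n * Q n.+1).
(* Decreasing because [Q n.+2 >= 2 * Q n]. *)
have u_ni m n : (m <= n)%N -> u n <= u m.
  elim: n => [|n IH]; first by rewrite leqn0 => /eqP->.
  rewrite leq_eqVlt => /orP[/eqP->//|/IH]; apply: le_trans.
  rewrite /u cS -addrA lerD2l.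
  have : 2 / (Q n.+1 * Q n.+2) <= (Q n * Q n.+1)^-1.
    rewrite ler_pdivrMr //.
    have -> : (Q n * Q n.+1)^-1 * (Q n.+1 * Q n.+2) = Q n.+2 / Q n.
      by field; rewrite (gt_eqF (Q0 n)) (gt_eqF (Q0 n.+1)).
    rewrite ler_pdivlMr //.
    have /andP[_ h1] := qE n; have /andP[h2 _] := qE n.+2.
    have := E4 n; have := E4 n.+1; have := E1 n.
    by rewrite /Q; lra.
  lra.
have c_le_u m n : c m <= u n.
  have [mn|nm] := leqP m n.
    by apply: (le_trans (c_nd _ _ mn)); rewrite lerDl divr_ge0 // ltW.
  by apply: le_trans (u_ni _ _ (ltnW nm)); rewrite lerDl divr_ge0 // ltW.
pose x := sup (range c).
have hs : has_sup (range c).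
  by split; [exists (c 0%N), 0%N | exists (u 0%N) => _ [m _ <-]].
have c_le n : c n <= x by apply: sup_upper_bound => //; exists n.
have le_u n : x <= u n.
  by apply: ge_sup; [exists (c 0%N), 0%N | move=> _ [m _ <-]].
exists x => n r.
pose D : R := (`|denq r|%N)%:R; rewrite -/D.
have D0 : 0 < D by rewrite ltr0n absz_gt0 denq_neq0.
have DE : (denq r)%:~R = D by rewrite /D natr_absz gtr0_norm.
have rE : ratr r = (numq r)%:~R / D by rewrite /ratr DE.
move=> close.
have {}close : `|x - ratr r| < (Q n * Q n.+1)^-1.
  apply: (lt_le_trans close); rewrite lef_pV2 ?posrE //; last first.
    by rewrite !mulr_gt0 //; apply: lt_le_trans (E1 _).
  have /andP[_ h1] := qE n; have /andP[_ h2] := qE n.+1.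
  have -> : 4 * E n * E n.+1 = (2 * E n) * (2 * E n.+1) by ring.
  by apply: ler_pM => //; exact: ltW.
have cn := c_le n.+1; rewrite cS in cn.
have xu := le_u n; rewrite /u in xu.
have sep : (D * Q n)^-1 <= `|ratr r - c n|.
  have -> : ratr r - c n = (numq r * q n - p n * denq r)%:~R / (D * Q n).
    by rewrite rE /c intrB !intrM DE -/(Q n); field; rewrite (gt_eqF (Q0 n)) (gt_eqF D0).
  rewrite normrM [`|_^-1|]gtr0_norm ?invr_gt0 ?mulr_gt0 //.
  rewrite ler_peMl ?invr_ge0 ?mulr_ge0 ?(ltW D0) ?(ltW (Q0 n)) //.
  rewrite -intr_norm -[1]/(1%:~R) ler_int -gtz0_ge1 normr_gt0.
  apply/eqP => z.
  have : ratr r = c n.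
    rewrite rE /c; apply/eqP; rewrite -subr_eq0; apply/eqP.
    transitivity ((numq r * q n - p n * denq r)%:~R / (D * Q n)).
      by rewrite intrB !intrM DE -/(Q n); field; rewrite (gt_eqF (Q0 n)) (gt_eqF D0).
    by rewrite z mul0r.
  by move=> e; move: close; rewrite e ger0_norm; lra.
have lt3 : `|ratr r - c n| < 3 / (Q n * Q n.+1).
  by move: close; rewrite !ltr_norml => /andP[h1 h2]; apply/andP; split; lra.
have := le_lt_trans sep lt3.
rewrite -[X in X < _]mul1r ltr_pdivlMr // mulrAC ltr_pdivrMr ?mulr_gt0 //.
rewrite mul1r [D * _]mulrC mulrCA ltr_pM2l // => h.
have /andP[h1 _] := qE n.+1; rewrite -/(Q n.+1) in h1.
by apply: (le_trans h1); exact: ltW.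
Qed.

End prescribed_denominators.

(** * Extremal point for the maximum, [d >= 3] *)

(* The coordinates have convergent denominators [exp (4 lam^k)], where [k] runs
   through the [i]-th residue class modulo [d] and [lam^d = d - 1]; this [lam]
   minimises [lam + lam^(1 - d)]. *)
Lemma H_max_extremal (R : realType) (d : nat) : (3 <= d)%N ->
  exists (x : 'rV[R]_d) (c : R), 0 < c /\
    forall r, c * (H_max r)%:R `^ (- max_exponent R d) <= `|x - rat_point R r|.
Proof.
move=> d3; have d0 : (0 < d)%N by lia.
have D0 : 0 < d%:R :> R by rewrite ltr0n.
pose L : R := d%:R - 1.
have L2 : 2 <= L by have := d3; rewrite -(ler_nat R) /L; lra.
have L0 : 0 < L by lra.
pose lam : R := L `^ d%:R^-1.
have lam0 : 0 < lam by exact: powR_gt0.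
have lamd : lam ^+ d = L.
  by rewrite -powR_mulrn ?(ltW lam0) // -powRrM mulVf ?gt_eqF // powRr1 // ltW.
have lam1 : 1 <= lam.
  have L1 : 1 <= L by lra.
  have V0 : 0 <= d%:R^-1 :> R by rewrite invr_ge0.
  by have := ler_powR L1 V0; rewrite powRr0.
(* As [d = L + 1] and [L = lam ^ d], this is [lam + lam ^ (1 - d)]. *)
have expE : max_exponent R d = lam * d%:R / L.
  rewrite /max_exponent -/L.
  have e : L `^ (L / d%:R) * lam = L.
    rewrite -powRD; last by rewrite (gt_eqF L0) implybT.
    have -> : L / d%:R + d%:R^-1 = 1 by rewrite /L; field; rewrite gt_eqF.
    by rewrite powRr1 // ltW.
  have P0 : 0 < L `^ (L / d%:R) by exact: powR_gt0.
  rewrite -[X in _ = _ / X]e; field; by rewrite (gt_eqF P0) (gt_eqF lam0).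
have d2 : (2 <= d)%N by lia.
have b0 := max_exponent_gt0 R d2.
pose E (i n : nat) : R := expR (4 * lam ^+ (d * n + i)).
have lamk k : 1 <= lam ^+ k by exact: exprn_ege1.
have E0 i : 1 <= E i 0%N by rewrite -expR0 ler_expR mulr_ge0 ?exprn_ge0 ?ltW.
have E4 i n : 4 * E i n <= E i n.+1.
  rewrite /E mulnS -addnA [lam ^+ (d + _)]exprD lamd.
  (* The ratio of successive scales is at least [1 + 4 (L - 1) >= 5]; [L >= 2] comes from
     [d >= 3]. *)
  have -> : 4 * (L * lam ^+ (d * n + i)) =
      4 * (L - 1) * lam ^+ (d * n + i) + 4 * lam ^+ (d * n + i) by ring.
  rewrite expRD ler_pM2r ?expR_gt0 //.
  apply: le_trans (expR_ge1Dx _).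
  have := lamk (d * n + i)%N; nra.
have [y yP] := choice (fun i : 'I_d => lacunary_number (E0 i) (E4 i)).
pose x : 'rV[R]_d := \row_i y i.
(* The threshold of [lacunary_number] for coordinate [k] mod [d] at scale [expR (4 * lam ^+ k)],
   whose successor is [expR (4 * L * lam ^+ k)]. *)
pose T (k : nat) : R := 4^-1 * expR (- (4 * (1 + L) * lam ^+ k)).
have T0 k : 0 < T k by rewrite mulr_gt0 ?invr_gt0 ?expR_gt0.
have near k r : `|x - rat_point R r| < T k ->
    expR (4 * L * lam ^+ k) <= 3 * (H_max r)%:R.
  move=> lt; pose i : 'I_d := Ordinal (ltn_pmod k d0).
  have kE : (d * (k %/ d) + i = k)%N by rewrite mulnC -divn_eq.
  have En : E i (k %/ d)%N = expR (4 * lam ^+ k) by rewrite /E kE.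
  have En1 : E i (k %/ d).+1 = expR (4 * L * lam ^+ k).
    by rewrite /E mulnS -addnA kE exprD lamd mulrA.
  rewrite -En1; apply: (@le_trans _ _ (3 * (denom r i)%:R)); last first.
    by rewrite ler_pM2l // ler_nat leq_theta_max.
  apply: yP; have := rat_point_coord_dist x r i; rewrite mxE => /le_lt_trans; apply.
  apply: (lt_le_trans lt).
  rewrite En En1 -mulrA -expRD invfM -expRN /T le_eqVlt; apply/orP; left.
  by apply/eqP; congr (_ * expR _); ring.
(* [T 0] serves the points at distance at least [T 0]; the other term absorbs the factor 3 of
   [near]. *)
pose c := Num.min (T 0%N) (4^-1 * 3 `^ (- max_exponent R d)).
have c0 : 0 < c by rewrite lt_min T0 mulr_gt0 ?invr_gt0 ?powR_gt0.
exists x, c; split => // r.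
have H1 : 1 <= (H_max r)%:R :> R by rewrite ler1n H_max_gt0.
have H0 : 0 < (H_max r)%:R :> R by rewrite ltr0n H_max_gt0.
(* Otherwise [near] at level [d * n] gives [expR (4 * L * L ^+ n) <= n], against [n < L ^+ n]. *)
have ex : exists k, T k <= `|x - rat_point R r|.
  apply: contrapT => nex.
  pose n := (3 * H_max r)%N.
  have := @near (d * n)%N r; rewrite ltNge.
  have -> /= : (T (d * n)%N <= `|x - rat_point R r|) = false.
    by apply/negP => h; apply: nex; exists (d * n)%N.
  move=> /(_ isT); rewrite exprM lamd -natrM -/n => h.
  have : n%:R < L ^+ n.
    apply: (@lt_le_trans _ _ (2 ^+ n)); first by rewrite -natrX ltr_nat ltn_expl.
    by rewrite lerXn2r ?nnegrE // ltW.
  have := expR_ge1Dx (4 * L * L ^+ n).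
  have : 0 < L ^+ n by rewrite exprn_gt0.
  nra.
case: (ex_minnP ex) => -[|k] kle kmin.
  apply: le_trans kle; apply: (@le_trans _ _ (T 0%N * 1)); last by rewrite mulr1.
  apply: ler_pM; rewrite ?powR_ge0 ?(ltW c0) //; first by rewrite ge_min lexx.
  rewrite powRN invf_le1 ?powR_gt0 //.
  by have := ler_powR H1 (ltW b0); rewrite powRr0.
have /near h : `|x - rat_point R r| < T k.
  rewrite ltNge; apply/negP => /kmin; lia.
apply: le_trans kle.
(* The critical case: the distance is at least [T k.+1] while the height is at least a third of
   [expR (4 * L * lam ^+ k)]. *)
have TE : T k.+1 = 4^-1 * expR (4 * L * lam ^+ k) `^ (- max_exponent R d).
  rewrite /T -expRM expE exprS; congr (_ * expR _).
  by rewrite /L; field; rewrite gt_eqF.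
apply: (@le_trans _ _ (4^-1 * 3 `^ (- max_exponent R d) *
    (H_max r)%:R `^ (- max_exponent R d))).
  by rewrite ler_wpM2r ?powR_ge0 // ge_min lexx orbT.
rewrite -mulrA -powRM ?(ltW H0) // TE ler_pM2l ?invr_gt0 //.
rewrite !powRN lef_pV2 ?posrE ?powR_gt0 ?expR_gt0 ?mulr_gt0 //.
by apply: ge0_ler_powR => //; rewrite ?nnegrE ?expR_ge0 ?(ltW b0).
Qed.

(** * Values of the three exponents *)

Lemma max_exponent2 (R : realType) : max_exponent R 2 = 2.
Proof. by rewrite /max_exponent (_ : 2 - 1 = 1) ?powR1 ?divr1 //; ring. Qed.

Lemma irr_exponent_ge (R : realType) (d : nat) (H : 'rV[rat]_d -> nat) (b : R) :
  (forall x, (b%:E <= irr_exponent_at H x)%E) -> (b%:E <= irr_exponent R H)%E.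
Proof. by move=> h; apply: le_ereal_inf_tmp => _ [x _ <-]. Qed.

Theorem theorem1p1 (R : realType) (d : nat) (hd : (1 <= d)%N) :
  [/\ (2 <= d)%N ->
        irr_exponent R (@H_max d) =
          (d%:R / (d%:R - 1) `^ ((d%:R - 1) / d%:R))%:E,
      irr_exponent R (@H_min d) = 2%:E
    & irr_exponent R (@H_prod d) = (2 / d%:R)%:E].
Proof.
have quarter : 0 < 4^-1 :> R by rewrite invr_gt0.
split.
- move=> d2; rewrite -/(max_exponent R d); apply/eqP; rewrite eq_le.
  apply/andP; split; last first.
    apply: irr_exponent_ge => x; apply: irr_exponent_at_ge.
      exact: max_exponent_gt0.
    by move=> a ha e; exact: H_max_approx.
  have b0 : 0 <= max_exponent R d by exact/ltW/max_exponent_gt0.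
  have [d3|dle2] := leqP 3 d.
    have [x [c [c0 far]]] := H_max_extremal R d3.
    by apply: (irr_exponent_le b0 c0 _ far) => r; exact: H_max_gt0.
  have dE : d = 2 by lia.
  subst d; rewrite max_exponent2 in b0 *.
  apply: (irr_exponent_le b0 quarter _ (sqrt2_row_H_max R hd)) => r.
  exact: H_max_gt0.
- apply/eqP; rewrite eq_le; apply/andP; split.
    apply: (irr_exponent_le _ quarter _ (sqrt2_row_H_min R hd)) => // r.
    exact: H_min_gt0.
  apply: irr_exponent_ge => x; apply: irr_exponent_at_ge => //.
  by move=> a ha e; exact: H_min_approx.
- apply/eqP; rewrite eq_le; apply/andP; split.
    apply: (irr_exponent_le _ quarter (@H_prod_gt0 d) (sqrt2_row_H_prod R hd)).
    by rewrite divr_ge0.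
  apply: irr_exponent_ge => x; apply: irr_exponent_at_ge.
    by rewrite divr_gt0 ?ltr0n.
  by move=> a ha e; exact: H_prod_approx.
Qed.
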